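(* Let $D>0$ be a square-free integer and let $$\Lambda=\{m+n\sqrt{D} : m,n\in\mathbb{Z},\ |m-n\sqrt{D}|\le 1\}\subset\mathbb{R}.$$ Suppose that $P_o\subset\Lambda$ has positive upper asymptotic density, i.e. $$\varlimsup_{n\to\infty}\frac{|P_o\cap[-n,n]|}{2n}>0 .$$ Then, for every finite set $F\subset\mathbb{Z}[\sqrt{D}]$, the set $$S_F=\{\lambda\in\Lambda : \exists\,\lambda_o\in P_o \text{ such that } \lambda_o+\lambda\cdot F\subset P_o\}$$ is syndetic in $\Lambda$.
   Context: Here $[-n,n]$ denotes the interval in $\mathbb{R}$, $|\cdot|$ applied to a set denotes cardinality, $\mathbb{Z}[\sqrt D]=\{m+n\sqrt D: m,n\in\mathbb{Z}\}$, and $\lambda\cdot F=\{\lambda f : f\in F\}$. A subset $S\subset\Lambda$ is syndetic in $\Lambda$ if there is a finite set $K\subset\mathbb{R}$ such that $\Lambda\subset S+K$. *)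

(* Defs.v *)
From mathcomp Require Import all_boot all_order all_algebra.
From mathcomp Require Import all_classical all_reals all_analysis.
Import Order.TTheory GRing.Theory Num.Theory.
Import numFieldNormedType.Exports.

Set Implicit Arguments.
Unset Strict Implicit.
Unset Printing Implicit Defensive.

Local Open Scope classical_set_scope.
Local Open Scope ring_scope.

(* 1 is square-free, as usual; for D = 1, [Zsqrt] and [Lambda] below are both the
   set of integers. *)
Definition square_free (D : nat) : Prop :=
  forall d : nat, (d ^ 2 %| D)%N -> d = 1%N.

Definition Zsqrt (R : realType) (D : nat) : set R :=
  [set x | exists m n : int, x = m%:~R + n%:~R * Num.sqrt D%:R].

Definition Lambda (R : realType) (D : nat) : set R :=
  [set x | exists m n : int, x = m%:~R + n%:~R * Num.sqrt D%:R
                          /\ `|m%:~R - n%:~R * Num.sqrt D%:R : R| <= 1].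

Arguments Zsqrt R D : clear implicits.
Arguments Lambda R D : clear implicits.

(* [counting] is the cardinality with value +oo on infinite sets. *)
Definition upper_density (R : realType) (P : set R) : \bar R :=
  limn_esup (fun n : nat =>
    (counting (P `&` `[- n%:R, n%:R]%classic)%R * ((2 * n%:R)^-1)%:E)%E).

Definition syndetic_in (R : realType) (L S : set R) : Prop :=
  S `<=` L /\
  exists2 K : set R, finite_set K & L `<=` [set s + k | s in S & k in K].

Definition return_set (R : realType) (L P F : set R) : set R :=
  [set l | L l /\
           exists2 l0, P l0 & [set l0 + x | x in [set l * f | f in F]] `<=` P].

(* Main.v *)
(** For D = 1 the theorem contains Szemerédi's theorem with syndetic common
    differences, so some form of the density Hales-Jewett theorem is needed.
    Given DHJ, suppose that S_F is not syndetic. Then one can choose greedily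
    l_1, ..., l_N in Lambda with very small conjugates such that no nonempty
    subset sum lies in S_F. Averaging over translates a yields an [a] for which
    the words w in F^N with a + sum_i l_i w_i in P_o have density at least some
    d > 0 independent of N, and a combinatorial line of such words shows that
    the sum of the l_i over its wildcards lies in S_F. Only the bound on the
    conjugates matters, not the irrationality of sqrt D.

    DHJ for the alphabet T + {None} is derived from DHJ for T along the lines of
    Polymath and of Dodos, Kanellopoulos and Tyros. Let d be the infimum of the
    densities forcing a line, suppose d > 0, and let A be line-free of density
    almost d; all its large fibres then have density close to d. A random
    T-subspace, with DHJ for T, produces a fibre B of A and sets D_u, each
    insensitive to exchanging the letters u and None, whose intersection has
    density bounded below and misses B. So B has density well above d relative
    to the complement of this intersection. But that complement can be tiled, up
    to a small error, by large subspaces, and B has density at most about d in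
    each of them. *)
Require Import Defs.
From mathcomp Require Import all_boot all_order all_algebra.
From mathcomp Require Import all_classical all_reals all_analysis.
From mathcomp Require Import lra ring zify.
Import Order.TTheory GRing.Theory Num.Theory.
Import numFieldNormedType.Exports.
Set Implicit Arguments.
Unset Strict Implicit.
Unset Printing Implicit Defensive.
Local Open Scope classical_set_scope.
Local Open Scope ring_scope.

(** * Averages over finite types *)

Section DensityHalesJewett.
Variable R : realType.
Implicit Types (I J K m : finType).

(* Junk value: an average over an empty type is 0, hence the witnesses [x0 : X]
   required below. *)
Definition avg (X : finType) (F : X -> R) : R := (\sum_x F x) / #|X|%:R.

Lemma avgD (X : finType) (F G : X -> R) :
  avg (fun x => F x + G x) = avg F + avg G.
Proof. by rewrite /avg big_split mulrDl. Qed.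

Lemma avgZ (X : finType) (c : R) (F : X -> R) :
  avg (fun x => c * F x) = c * avg F.
Proof. by rewrite /avg -mulr_sumr mulrA. Qed.

Lemma avgB (X : finType) (F G : X -> R) :
  avg (fun x => F x - G x) = avg F - avg G.
Proof. by rewrite /avg sumrB mulrBl. Qed.

Lemma avg_sum (X : finType) (C : Type) (r : seq C) (P : pred C) (F : C -> X -> R) :
  avg (fun x => \sum_(c <- r | P c) F c x) = \sum_(c <- r | P c) avg (F c).
Proof. by rewrite /avg exchange_big mulr_suml. Qed.

Lemma card_inhab (X : finType) (x0 : X) : 0 < #|X|%:R :> R.
Proof. by rewrite ltr0n; apply/card_gt0P; exists x0. Qed.

Lemma avg_cst (X : finType) (x0 : X) (c : R) : avg (fun _ : X => c) = c.
Proof.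
have := card_inhab x0; rewrite /avg sumr_const -[c *+ _]mulr_natr => h.
by rewrite mulfK // gt_eqF.
Qed.

Lemma eq_avg (X : finType) (F G : X -> R) : F =1 G -> avg F = avg G.
Proof. by move=> FG; rewrite /avg (eq_bigr G). Qed.

Lemma ler_avg (X : finType) (F G : X -> R) :
  (forall x, F x <= G x) -> avg F <= avg G.
Proof.
by move=> FG; rewrite /avg ler_wpM2r ?invr_ge0 ?ler0n // ler_sum.
Qed.

Lemma avg_ge0 (X : finType) (F : X -> R) : (forall x, 0 <= F x) -> 0 <= avg F.
Proof. by move=> F0; rewrite /avg divr_ge0 ?ler0n // sumr_ge0. Qed.

Lemma avg_ex (X : finType) (x0 : X) (c : R) (F : X -> R) :
  c <= avg F -> exists x, c <= F x.
Proof.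
move=> cF; apply: contrapT => /forallNP FN.
have h0 := card_inhab x0.
move: cF; rewrite /avg ler_pdivlMr // leNgt => /negP; apply.
have -> : c * #|X|%:R = \sum_(x : X) c by rewrite sumr_const mulr_natr.
apply: ltr_sum.
  by apply/hasP; exists x0 => //; rewrite mem_index_enum.
by move=> x _; rewrite ltNge; apply/negP/FN.
Qed.

Lemma avg_exchange (X Y : finType) (F : X -> Y -> R) :
  avg (fun x => avg (F x)) = avg (fun y => avg (F^~ y)).
Proof.
rewrite /avg -!mulr_suml exchange_big /=.
by rewrite -!mulrA [_^-1 * _]mulrC.
Qed.

Lemma avg_bij (X Y : finType) (h : Y -> X) (F : X -> R) :
  bijective h -> avg F = avg (fun y => F (h y)).
Proof.
move=> bh; rewrite /avg (bij_eq_card bh).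
by congr (_ / _); rewrite (reindex h) //; exact: onW_bij.
Qed.

Lemma avg_pair (X Y : finType) (F : X * Y -> R) :
  avg F = avg (fun x => avg (fun y => F (x, y))).
Proof.
rewrite /avg -mulr_suml -mulrA card_prod natrM invfM [_^-1 * _]mulrC.
congr (_ * _); rewrite pair_big /=.
by apply: eq_bigr => -[].
Qed.

(** Pointwise, [F z] is at most [b / 2] plus the number of [c] with [r z c]; averaging leaves
    [b / 2] to share among the [#|C|] choices. This fixes one line or subspace for many [z] at
    once. *)
Lemma avg_pigeonhole (Z C : finType) (b : R) (F : Z -> R) (r : Z -> C -> bool) :
  0 < b -> (forall z, F z <= 1) ->
  (forall z, b / 2 <= F z -> exists c, r z c) -> b <= avg F ->
  exists c, b / 2 / #|C|%:R <= avg (fun z => (r z c)%:R).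
Proof.
move=> b0 F1 Fr bF.
have [z0|nZ] := pickP (fun _ : Z => true); last first.
  move: bF; rewrite /avg (eq_bigl _ _ nZ) big_pred0_eq mul0r => bF.
  by move: (lt_le_trans b0 bF); rewrite ltxx.
move=> _.
have [z /(le_trans _) h] := avg_ex z0 bF.
have [c0 _] : exists c, r z c by apply: Fr; apply: h; lra.
apply: (avg_ex c0).
rewrite avg_exchange /avg.
have -> : forall f : Z -> R, (\sum_z f z / #|C|%:R) = (\sum_z f z) / #|C|%:R.
  by move=> f; rewrite mulr_suml.
rewrite [leRHS]mulrAC; apply: ler_wpM2r; first by rewrite invr_ge0 ler0n.
rewrite -[leRHS]/(avg _).
have : avg F <= avg (fun z => b / 2 + \sum_c (r z c)%:R).
  apply: ler_avg => y; case: (leP (b / 2) (F y)) => [/Fr[c rc]|]; last first.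
    move=> /ltW /le_trans; apply; rewrite lerDl.
    by apply: sumr_ge0 => c _; rewrite ler0n.
  rewrite (bigD1 c) //= rc; apply: le_trans (F1 y) _.
  rewrite addrCA lerDl addr_ge0 //; first by lra.
  by apply: sumr_ge0 => ? _; rewrite ler0n.
rewrite avgD (avg_cst z0) => h2.
lra.
Qed.

(** * Words, lines and subspaces *)

Definition cat_word (T : Type) I J (x : {ffun I -> T}) (y : {ffun J -> T}) :
  {ffun I + J -> T} :=
  [ffun k => match k with inl i => x i | inr j => y j end].

Lemma avg_cat (T I J : finType) (F : {ffun I + J -> T} -> R) :
  avg F = avg (fun x => avg (fun y => F (cat_word x y))).
Proof.
rewrite -(avg_pair (fun p => F (cat_word p.1 p.2))).
apply: avg_bij.
exists (fun z : {ffun I + J -> T} => ([ffun i => z (inl i)], [ffun j => z (inr j)])).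
  by move=> [x y]; congr pair; apply/ffunP => i; rewrite !ffunE.
by move=> z; apply/ffunP => -[i|j]; rewrite !ffunE.
Qed.

Definition mix (T : Type) I J (h : J -> I) (x : {ffun I -> T}) (y : {ffun J -> T}) :
  {ffun I -> T} :=
  [ffun i => if [pick j | h j == i] is Some j then y j else x i].

Lemma mix_in (T : Type) I J (h : J -> I) (x : {ffun I -> T}) (y : {ffun J -> T}) j :
  injective h -> mix h x y (h j) = y j.
Proof.
move=> hi; rewrite ffunE; case: pickP => [k /eqP /hi -> //|/(_ j)].
by rewrite eqxx.
Qed.

Lemma mix_out (T : Type) I J (h : J -> I) (x : {ffun I -> T}) (y : {ffun J -> T}) i :
  (forall j, h j != i) -> mix h x y i = x i.
Proof.
by move=> hi; rewrite ffunE; case: pickP => [k|//]; rewrite (negbTE (hi k)).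
Qed.

(** Exchanging [y] with the restriction of [x] along [h] is an involution of the pairs, so
    [mix h x y] is again uniform. *)
Lemma avg_mix (T I J : finType) (t0 : T) (h : J -> I) (F : {ffun I -> T} -> R) :
  injective h -> avg F = avg (fun x => avg (fun y => F (mix h x y))).
Proof.
move=> hi.
rewrite -(avg_pair (fun p => F (mix h p.1 p.2))).
pose s (p : {ffun I -> T} * {ffun J -> T}) :=
  (mix h p.1 p.2, [ffun j => p.1 (h j)] : {ffun J -> T}).
have sK : involutive s.
  move=> [x y]; rewrite /s /=; congr pair; last first.
    by apply/ffunP => j; rewrite ffunE mix_in.
  apply/ffunP => i; rewrite [LHS]ffunE; case: pickP => [j /eqP <-|out].
    by rewrite ffunE.
  by rewrite mix_out // => j; rewrite out.
rewrite -(avg_bij (fun p => F p.1) (inv_bij sK)) avg_pair.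
by apply: eq_avg => x /=; rewrite (avg_cst (X := {ffun J -> T}) [ffun=> t0]).
Qed.

(* A word over [option T] containing [None] is a line template, [None] being
   the wildcard. *)
Definition is_line (T : Type) I (l : {ffun I -> option T}) : Prop :=
  exists i, l i = None.

Definition inst (T : Type) I (l : {ffun I -> option T}) (t : T) : {ffun I -> T} :=
  [ffun i => odflt t (l i)].

Definition has_line (T : finType) I (A : {ffun I -> T} -> bool) : Prop :=
  exists2 l : {ffun I -> option T}, is_line l & forall t, A (inst l t).

(* A word over [T + m] in which every [inr j] occurs is an [m]-dimensional
   combinatorial subspace, [inr j] being the [j]-th wildcard. *)
Definition is_space (T : Type) m I (V : {ffun I -> T + m}) : Prop :=
  forall j, exists i, V i = inr j.

Definition app (T : Type) m I (V : {ffun I -> T + m}) (x : {ffun m -> T}) :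
  {ffun I -> T} :=
  [ffun i => match V i with inl t => t | inr j => x j end].

Lemma app_inj (T : Type) m I (V : {ffun I -> T + m}) :
  is_space V -> injective (app V).
Proof.
move=> Vs x y /ffunP e; apply/ffunP => j; have [i Vi] := Vs j.
by have := e i; rewrite !ffunE Vi.
Qed.

Definition app_space (T : Type) m (k : finType) I (V : {ffun I -> T + m}) (U : {ffun m -> T + k}) :
  {ffun I -> T + k} :=
  [ffun i => match V i with inl t => inl t | inr j => U j end].

Lemma app_app (T : Type) m (k : finType) I (V : {ffun I -> T + m}) (U : {ffun m -> T + k}) x :
  app V (app U x) = app (app_space V U) x.
Proof. by apply/ffunP => i; rewrite !ffunE; case: (V i) => // j; rewrite ffunE. Qed.

Lemma app_space_is_space (T : Type) m (k : finType) I
    (V : {ffun I -> T + m}) (U : {ffun m -> T + k}) :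
  is_space V -> is_space U -> is_space (app_space V U).
Proof.
move=> Vs Us j; have [i Ui] := Us j; have [p Vp] := Vs i.
by exists p; rewrite ffunE Vp.
Qed.

Lemma has_line_app (T : finType) m I (V : {ffun I -> T + m}) A :
  is_space V -> has_line (fun x => A (app V x)) -> has_line A.
Proof.
move=> Vs [l [j lj] lA].
exists [ffun i => match V i with inl t => Some t | inr j => l j end].
  by have [i Vi] := Vs j; exists i; rewrite ffunE Vi.
move=> t; rewrite (_ : inst _ t = app V (inst l t)) //.
by apply/ffunP => i; rewrite !ffunE; case: (V i) => //= k; rewrite ffunE.
Qed.

Definition dens (T : finType) I (A : {ffun I -> T} -> bool) : R :=
  avg (fun x => (A x)%:R).

Definition DHJ_at (T : finType) (d : R) : Prop :=
  exists I : finType, forall A : {ffun I -> T} -> bool, d <= dens A -> has_line A.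

Definition DHJ (T : finType) : Prop := forall d, 0 < d -> DHJ_at T d.

Lemma dens_le1 (T : finType) I (t0 : T) (A : {ffun I -> T} -> bool) : dens A <= 1.
Proof.
rewrite -[leRHS](avg_cst (X := {ffun I -> T}) [ffun=> t0]).
by apply: ler_avg => x; rewrite lern1 leq_b1.
Qed.

Lemma dens_ex (T : finType) I (t0 : T) (A : {ffun I -> T} -> bool) :
  0 < dens A -> exists x, A x.
Proof.
move=> dA; have [x] := avg_ex [ffun=> t0] (lexx (dens A)).
move/(lt_le_trans dA); case Ax: (A x); first by exists x.
by rewrite ltxx.
Qed.

(** DHJ on a first block gives lines for many continuations [z]; by pigeonhole one line serves a
    dense set of [z], in which the second block finds a subspace of one dimension less. *)
Lemma multidim_DHJ_ord (T : finType) (t0 : T) (n : nat) : DHJ T ->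
  forall d, 0 < d -> exists I : finType, forall A : {ffun I -> T} -> bool,
    d <= dens A -> exists2 V : {ffun I -> T + 'I_n}, is_space V & forall x, A (app V x).
Proof.
move=> dhj; elim: n => [|n IHn] d d0.
  exists unit => A /(lt_le_trans d0) /(dens_ex t0)[y Ay].
  exists [ffun i => inl (y i)]; first by case.
  by move=> x; rewrite (_ : app _ _ = y) //; apply/ffunP => i; rewrite !ffunE.
have d20 : 0 < d / 2 by lra.
have [I1 I1P] := dhj _ d20.
have c0 : 0 < d / 2 / #|{ffun I1 -> option T}|%:R.
  by rewrite divr_gt0 ?(card_inhab [ffun=> None]).
have [I2 I2P] := IHn _ c0.
exists (I1 + I2)%type => A dA.
pose r (z : {ffun I2 -> T}) (l : {ffun I1 -> option T}) :=
  `[< is_line l /\ forall t, A (cat_word (inst l t) z) >].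
have [|||l] := @avg_pigeonhole _ _ d (fun z => dens (fun y => A (cat_word y z))) r d0.
- by move=> z; exact: dens_le1.
- by move=> z /I1P[l ll lA]; exists l; apply/asboolP.
- by move: dA; rewrite /dens avg_cat avg_exchange.
move=> /I2P[V Vs VA].
have ll : is_line l by have /asboolP[] := VA [ffun=> t0].
exists [ffun k => match k with
  | inl i => if l i is Some t then inl t else inr ord0
  | inr i => match V i with inl t => inl t | inr j => inr (lift ord0 j) end end].
  move=> j; case: (unliftP ord0 j) => [k ->|->].
    by have [i Vi] := Vs k; exists (inr i); rewrite ffunE Vi.
  by case: ll => i li; exists (inl i); rewrite ffunE li.
move=> x; have /asboolP[_ /(_ (x ord0))] := VA [ffun j => x (lift ord0 j)].
congr (is_true (A _)); apply/ffunP => -[i|i]; rewrite !ffunE.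
  by case: (l i).
by case: (V i) => // k; rewrite ffunE.
Qed.

Lemma multidim_DHJ (T m : finType) (t0 : T) (d : R) : DHJ T -> 0 < d ->
  exists I : finType, forall A : {ffun I -> T} -> bool, d <= dens A ->
    exists2 V : {ffun I -> T + m}, is_space V & forall x, A (app V x).
Proof.
move=> dhj d0; have [I IP] := multidim_DHJ_ord t0 #|m| dhj d0.
exists I => A /IP[V Vs VA].
exists [ffun i => match V i with inl t => inl t | inr j => inr (enum_val j) end].
  by move=> j; have [i Vi] := Vs (enum_rank j); exists i; rewrite ffunE Vi enum_rankK.
move=> x; have := VA [ffun j => x (enum_val j)].
congr (is_true (A _)); apply/ffunP => i; rewrite !ffunE.
by case: (V i) => // j; rewrite ffunE.
Qed.

Lemma avg_eq1 (X : finType) (x0 : X) : avg (fun x => (x == x0)%:R) = #|X|%:R^-1 :> R.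
Proof.
rewrite /avg (bigD1 x0) //= eqxx big1 ?addr0 ?div1r // => x /negbTE -> //.
Qed.

(** * Insensitive sets *)

Definition relabel (T : finType) I (z : {ffun I -> option T}) (y : {ffun I -> T}) :
  {ffun I -> option T} := [ffun p => if z p is Some _ then Some (y p) else None].

Lemma avg_relabel (T I : finType) (t0 : T) (F : {ffun I -> option T} -> R) :
  avg F = avg (fun z => avg (fun y => F (relabel z y))).
Proof.
rewrite -(avg_pair (fun p => F (relabel p.1 p.2))).
pose s (p : {ffun I -> option T} * {ffun I -> T}) :=
  (relabel p.1 p.2, [ffun i => odflt (p.2 i) (p.1 i)] : {ffun I -> T}).
have sK : involutive s.
  move=> [x y]; rewrite /s /=; congr pair; apply/ffunP => i; rewrite !ffunE;
  by case: (x i).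
rewrite -(avg_bij (fun p => F p.1) (inv_bij sK)) avg_pair.
by apply: eq_avg => x /=; rewrite (avg_cst (X := {ffun I -> T}) [ffun=> t0]).
Qed.

(* [inst x i0] turns the [None]s of [x] into [i0], so [E] does not distinguish the
   letters [Some i0] and [None]. *)
Definition insensitive (T : finType) I (i0 : T) (E : {ffun I -> option T} -> bool) : Prop :=
  forall x y, inst x i0 = inst y i0 -> E x = E y.

(* Given the positions of its [None]s, a uniform word over [option T] is uniform
   over [T] elsewhere, so DHJ for [T] applies there; insensitivity extends the
   resulting subspace to the alphabet [option T]. Rows of length [k] ensure that
   enough positions do not carry [None]. *)
Lemma insensitive_space (T m : finType) (t0 : T) (b : R) : DHJ T -> 0 < b ->
  exists I : finType, forall (i0 : T) (E : {ffun I -> option T} -> bool),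
    insensitive i0 E -> b <= dens E ->
    exists2 V : {ffun I -> option T + m}, is_space V & forall x, E (app V x).
Proof.
move=> dhj b0; have b20 : 0 < b / 2 by lra.
have [I0 I0P] := multidim_DHJ m t0 dhj b20.
(* With rows of this length, the expected number of rows consisting of [None] only is at most
   [b / 2]. *)
pose k := Num.bound (#|I0|%:R / (b / 2)).
have hk : #|I0|%:R / #|{ffun 'I_k -> option T}|%:R <= b / 2.
  rewrite ler_pdivrMr ?(card_inhab [ffun=> None]) // mulrC -ler_pdivrMr //.
  have r0 : 0 <= #|I0|%:R / (b / 2) by rewrite divr_ge0 ?ler0n // ltW.
  rewrite (le_trans (ltW (archi_boundP r0))) // ler_nat -/k.
  rewrite card_ffun card_ord card_option (leq_trans (ltnW (ltn_expl k (isT : 1 < 2)%N))) //.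
  have [->|k1] := posnP k; first by rewrite !expn0.
  by rewrite leq_exp2r // ltnS; apply/card_gt0P; exists t0.
exists (I0 * 'I_k)%type => i0 E Ei bE.
pose bad i (z : {ffun I0 * 'I_k -> option T}) := [forall c, z (i, c) == None].
have badP i : avg (fun z => (bad i z)%:R) = #|{ffun 'I_k -> option T}|%:R^-1 :> R.
  rewrite (avg_mix (J := 'I_k) None (h := fun c => (i, c))); last by move=> ? ? [].
  rewrite -(avg_eq1 [ffun=> None]).
  rewrite -[RHS](avg_cst (X := {ffun I0 * 'I_k -> option T}) [ffun=> None]).
  apply: eq_avg => z; apply: eq_avg => y; congr (_%:R); congr (nat_of_bool _).
  apply/forallP/eqP => [h|-> c].
    apply/ffunP => c; rewrite ffunE; have /eqP := h c.
    by rewrite (mix_in (h := fun c => (i, c))) // => ? ? [].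
  by rewrite (mix_in (h := fun c => (i, c))) ?ffunE // => ? ? [].
pose G z : R := avg (fun y => (E (relabel z y))%:R).
have [z zP] : exists z, b / 2 <= G z - \sum_i (bad i z)%:R.
  apply: (avg_ex [ffun=> None]); rewrite avgB -(avg_relabel t0 (fun z => (E z)%:R)).
  rewrite avg_sum; under eq_bigr do rewrite badP.
  rewrite sumr_const -mulr_natl.
  by rewrite -/(dens E); lra.
have s0 : 0 <= \sum_i (bad i z)%:R :> R by apply: sumr_ge0 => i _; rewrite ler0n.
have G1 : G z <= 1 by exact: (dens_le1 t0 (fun y => E (relabel z y))).
have bz : b / 2 <= G z by lra.
have /fin_all_exists[c cP] : forall i, exists c, z (i, c) != None.
  move=> i; have : ~~ bad i z; last by rewrite negb_forall => /existsP.
  apply/negP => bi; have : 1 <= \sum_i (bad i z)%:R :> R; last by lra.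
  rewrite (bigD1 i) //= bi lerDl; apply: sumr_ge0 => ? _.
  by rewrite ler0n.
pose h i := (i, c i).
have hi : injective h by move=> ? ? [].
move: bz; rewrite /G (avg_mix t0 _ hi) => /(avg_ex [ffun=> t0])[y].
move/I0P => [U Us UE].
exists [ffun p => if z p is Some _ then
  if [pick i | h i == p] is Some i then
    match U i with inl t => inl (Some t) | inr j => inr j end
  else inl (Some (y p)) else inl None].
  move=> j; have [i Ui] := Us j; exists (h i); rewrite ffunE.
  case: (z (h i)) (cP i) => // a _.
  by case: pickP => [i' /eqP /hi -> |/(_ i)]; rewrite ?Ui ?eqxx.
(* The two words differ only at wildcards, where one carries [inst x i0] and the other [x]. *)
move=> x; rewrite -(_ : E (relabel z (mix h y (app U (inst x i0)))) = E (app _ x)) //.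
apply: Ei; apply/ffunP => p; rewrite !ffunE.
case: (z p) => //= _; case: pickP => [i _|//].
by rewrite !ffunE; case: (U i) => //= j; rewrite ffunE.
Qed.

Lemma avg_image (X Y : finType) (x0 : X) (h : X -> Y) (g : Y -> R) : injective h ->
  avg (fun y => [exists x, h x == y]%:R * g y) =
  #|X|%:R / #|Y|%:R * avg (fun x => g (h x)).
Proof.
move=> hi; have X0 := card_inhab x0.
rewrite /avg [RHS]mulrC mulrA divfK ?gt_eqF //; congr (_ / _).
transitivity (\sum_y \sum_x (h x == y)%:R * g y).
  apply: eq_bigr => y _; case: existsP => [[x /eqP <-]|hy].
    rewrite (bigD1 x) //= eqxx big1 ?addr0 // => z.
    by rewrite (inj_eq hi) => /negbTE ->; rewrite mul0r.
  rewrite mul0r big1 // => x _; case: eqP => [hx|]; rewrite ?mul0r //.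
  by case: hy; exists x; apply/eqP.
rewrite exchange_big /=; apply: eq_bigr => x _.
rewrite (bigD1 (h x)) //= eqxx mul1r big1 ?addr0 // => y.
by rewrite eq_sym => /negbTE ->; rewrite mul0r.
Qed.

Definition letters (T : Type) I m (y : {ffun I -> T}) : {ffun I -> T + m} :=
  [ffun i => inl (y i)].

Lemma app_cat (T : Type) I J m (V : {ffun I -> T + m}) (U : {ffun J -> T + m}) x :
  app (cat_word V U) x = cat_word (app V x) (app U x).
Proof. by apply/ffunP => -[i|j]; rewrite !ffunE. Qed.

Lemma app_letters (T : Type) I m (y : {ffun I -> T}) (x : {ffun m -> T}) :
  app (letters m y) x = y.
Proof. by apply/ffunP => i; rewrite !ffunE. Qed.

Lemma inst_cat (T : Type) I J (x : {ffun I -> option T}) (y : {ffun J -> option T}) t :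
  inst (cat_word x y) t = cat_word (inst x t) (inst y t).
Proof. by apply/ffunP => -[i|j]; rewrite !ffunE. Qed.

Lemma is_space_catl (T : Type) I J m (V : {ffun I -> T + m}) (U : {ffun J -> T + m}) :
  is_space V -> is_space (cat_word V U).
Proof. by move=> Vs j; have [i Vi] := Vs j; exists (inl i); rewrite ffunE. Qed.

Lemma is_space_catr (T : Type) I J m (V : {ffun I -> T + m}) (U : {ffun J -> T + m}) :
  is_space U -> is_space (cat_word V U).
Proof. by move=> Us j; have [i Ui] := Us j; exists (inr i); rewrite ffunE. Qed.

(* Up to an error [b], an insensitive set is tiled by [m]-dimensional subspaces.
   As long as [E] has density above [b / 2], one finds a subspace [V] of the first
   block of coordinates and a dense set [Z] of continuations with [V * Z] inside
   [E]; removing it leaves fibres that are again insensitive, on the remaining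
   coordinates, and shrinks the density of [E] by a factor [1 - e]. *)
Lemma insensitive_sum (T m : finType) (t0 : T) (b : R) : DHJ T -> 0 < b ->
  exists I : finType, forall i0 E (f : {ffun I -> option T} -> R),
    insensitive i0 E -> (forall x, f x <= 1) ->
    (forall V : {ffun I -> option T + m}, is_space V -> avg (fun x => f (app V x)) <= 0) ->
    avg (fun x => (E x)%:R * f x) <= b.
Proof.
move=> dhj b0.
pose n0 I : {ffun I -> option T} := [ffun=> None].
have trivial_bound I (E : {ffun I -> option T} -> bool) f : (forall x, f x <= 1) ->
    avg (fun x => (E x)%:R * f x) <= dens E.
  by move=> f1; apply: ler_avg => x; case: (E x); rewrite ?mul1r ?mul0r.
have [b1|b1] := leP 1 b.
  exists unit => i0 E f _ f1 _; apply: le_trans (trivial_bound _ E f f1) _.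
  exact: le_trans (dens_le1 None E) b1.
have b20 : 0 < b / 2 by lra.
have b40 : 0 < b / 2 / 2 by lra.
have [I1 I1P] := insensitive_space m t0 dhj b40.
pose W := {ffun I1 -> option T}; pose C := {ffun I1 -> option T + m}.
(* A lower bound for the share of words removed in one round: [b / 2 / 2 / #|C|] of the
   continuations, times at least one of the [#|W|] words of the first block. *)
pose e : R := b / 2 / 2 / #|C|%:R / #|W|%:R.
have nat_ge1 (X : finType) (x0 : X) : 1 <= #|X|%:R :> R.
  by rewrite ler1n; apply/card_gt0P; exists x0.
have C1 : 1 <= #|C|%:R :> R := nat_ge1 C [ffun=> inl None].
have W1 : 1 <= #|W|%:R :> R := nat_ge1 W (n0 _).
have e0 : 0 < e by rewrite !divr_gt0 //; lra.
have e1 : e <= 1.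
  have := mulr_ege1 C1 W1 => CW1.
  by rewrite /e -mulrA -invfM ler_pdivrMr ?mul1r; lra.
have [j jP] : exists j, (1 - e) ^+ j <= b / 2.
  have : `|1 - e| < 1 by rewrite ger0_norm; lra.
  move=> /cvg_expr /cvgrPdist_le /(_ _ b20)[N _ /(_ N (leqnn N))].
  by rewrite sub0r normrN => /(le_trans (ler_norm _)); exists N.
suff [I IP] : exists I : finType, forall i0 E (f : {ffun I -> option T} -> R),
    insensitive i0 E -> (forall x, f x <= 1) ->
    (forall V : {ffun I -> option T + m}, is_space V -> avg (fun x => f (app V x)) <= 0) ->
    avg (fun x => (E x)%:R * f x) <= b / 2 + (1 - e) ^+ j * dens E.
  exists I => i0 E f Ei f1 fV; apply: le_trans (IP _ _ _ Ei f1 fV) _.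
  have := dens_le1 None E; have : 0 <= dens E by apply: avg_ge0 => x; rewrite ler0n.
  by move: jP; nra.
move: {jP}j; elim=> [|j [I2 IH]].
  exists unit => i0 E f _ f1 _; apply: le_trans (trivial_bound _ E f f1) _.
  by rewrite expr0 mul1r; lra.
exists (I1 + I2)%type => i0 E f Ei f1 fV.
have dE0 : 0 <= dens E by apply: avg_ge0 => x; rewrite ler0n.
have dE1 : dens E <= 1 by exact: (dens_le1 None E).
have cj k : 0 <= (1 - e) ^+ k by rewrite exprn_ge0 //; lra.
have [dE|dE] := leP (dens E) (b / 2).
  apply: le_trans (trivial_bound _ E f f1) _; apply: le_trans dE _.
  by rewrite lerDl mulr_ge0.
pose r (z : {ffun I2 -> option T}) (V : C) :=
  `[< is_space V /\ forall x, E (cat_word (app V x) z) >].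
have [|||V VP] := @avg_pigeonhole _ _ (b / 2) (fun z => dens (fun y => E (cat_word y z))) r b20.
- by move=> z; exact: (dens_le1 None _).
- move=> z /(I1P i0)[|V Vs VE]; last by exists V; apply/asboolP.
  by move=> x y xy; apply: Ei; rewrite !inst_cat xy.
- by move: (ltW dE); rewrite /dens avg_cat avg_exchange.
have Vs : is_space V.
  have [|z] := dens_ex (A := fun z => r z V) None (lt_le_trans _ VP).
    by rewrite divr_gt0 //; lra.
  by move=> /asboolP[].
pose Z z := r z V; pose im y := [exists x, app V x == y].
pose E' y z := E (cat_word y z) && ~~ (im y && Z z).
have imZ y z : im y -> Z z -> E (cat_word y z).
  by move=> /existsP[x /eqP <-] /asboolP[].
(* Membership in [Z] is defined through [E] alone, hence is insensitive as well. *)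
have Ei' y : insensitive i0 (E' y).
  move=> z z' zz'; rewrite /E' (Ei _ (cat_word y z')) ?inst_cat ?zz' //.
  rewrite (_ : Z z = Z z') //; apply: asbool_equiv_eq.
  have Ezz x : E (cat_word (app V x) z) = E (cat_word (app V x) z').
    by apply: Ei; rewrite !inst_cat zz'.
  by split=> -[_ h]; split=> // x; [rewrite -Ezz|rewrite Ezz].
have X1 : 1 <= #|{ffun m -> option T}|%:R :> R by apply: nat_ge1; exact: [ffun=> None].
have tiles (g : W -> {ffun I2 -> option T} -> R) :
    avg (fun y => avg (fun z => (im y && Z z)%:R * g y z)) =
    #|{ffun m -> option T}|%:R / #|W|%:R * avg (fun z => (Z z)%:R * avg (fun x => g (app V x) z)).
  have -> : avg (fun y => avg (fun z => (im y && Z z)%:R * g y z)) =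
      avg (fun y => (im y)%:R * avg (fun z => (Z z)%:R * g y z)).
    apply: eq_avg => y; rewrite -avgZ; apply: eq_avg => z.
    by rewrite -mulnb natrM mulrA.
  rewrite (avg_image (Y := W) (n0 m) (fun y => avg (fun z => (Z z)%:R * g y z)) (app_inj Vs)).
  congr (_ * _); rewrite avg_exchange; apply: eq_avg => z.
  by rewrite -avgZ.
have -> : avg (fun x => (E x)%:R * f x) =
    avg (fun y => avg (fun z => (E' y z)%:R * f (cat_word y z))) +
    avg (fun y => avg (fun z => (im y && Z z)%:R * f (cat_word y z))).
  rewrite avg_cat -avgD; apply: eq_avg => y; rewrite -avgD; apply: eq_avg => z.
  rewrite /E' -mulrDl; congr (_ * _).
  case ym: (im y); case zZ: (Z z); rewrite /= ?andbT ?addr0 //.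
  by rewrite (imZ _ _ ym zZ) add0r.
have dE' : avg (fun y => dens (E' y)) <= (1 - e) * dens E.
  have -> : avg (fun y => dens (E' y)) = dens E -
    avg (fun y => avg (fun z => (im y && Z z)%:R * 1)).
    rewrite /dens [avg (fun x => (E x)%:R)]avg_cat -avgB.
    apply: eq_avg => y; rewrite -avgB; apply: eq_avg => z.
    rewrite /E' mulr1; case ym: (im y); case zZ: (Z z); rewrite /= ?andbT ?subr0 //.
    by rewrite (imZ _ _ ym zZ) subrr.
  rewrite tiles.
  under eq_avg do rewrite (avg_cst (n0 m)) mulr1.
  have : e <= #|{ffun m -> option T}|%:R / #|W|%:R * avg (fun z => (Z z)%:R).
    rewrite mulrAC /e ler_wpM2r ?invr_ge0 ?ler0n //.
    apply: le_trans VP _; rewrite ler_peMl //.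
    by apply: avg_ge0 => z; rewrite ler0n.
  nra.
have -> : b / 2 + (1 - e) ^+ j.+1 * dens E = b / 2 + (1 - e) ^+ j * ((1 - e) * dens E) + 0.
  by rewrite exprSr mulrA addr0.
(* For each [z] in [Z] the removed tile is the subspace [V] followed by the letters of [z], where
   [f] has nonpositive average. The rest is handled fibrewise by induction. *)
apply: lerD; last first.
  rewrite tiles mulr_ge0_le0 ?divr_ge0 ?ler0n //.
  rewrite -[leRHS](avg_cst (n0 I2)); apply: ler_avg => z.
  rewrite mulr_ge0_le0 ?ler0n //.
  have := fV (cat_word V (letters m z)) (is_space_catl _ Vs).
  by under eq_avg do rewrite app_cat app_letters.
apply: (@le_trans _ _ (avg (fun y : W => b / 2 + (1 - e) ^+ j * dens (E' y)))); last first.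
  by rewrite avgD (avg_cst (n0 I1)) avgZ lerD2l ler_wpM2l.
apply: ler_avg => y; apply: (IH i0) => // U Us.
have := fV (cat_word (letters m y) U) (is_space_catr _ Us).
by under eq_avg do rewrite app_cat app_letters.
Qed.

Lemma insensitive_app (T m I : finType) (V : {ffun I -> option T + m}) (u : T) E :
  insensitive u E -> insensitive u (fun x => E (app V x)).
Proof.
move=> Eu x y xy; apply: Eu; apply/ffunP => i; rewrite !ffunE.
by case: (V i) => // j; have /ffunP/(_ j) := xy; rewrite !ffunE.
Qed.

(* [p] is an arbitrary Boolean combination of the sets [E u], [u] in [s]. *)
Lemma insensitive_algebra_sum (T m : finType) (t0 : T) (r : nat) (b : R) :
  DHJ T -> 0 < b ->
  exists I : finType, forall (s : seq T) (E : T -> {ffun I -> option T} -> bool)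
      (p : seq bool -> bool) (f : {ffun I -> option T} -> R),
    size s = r -> (forall u, insensitive u (E u)) -> (forall x, f x <= 1) ->
    (forall V : {ffun I -> option T + m}, is_space V -> avg (fun x => f (app V x)) <= 0) ->
    avg (fun x => (p [seq E u x | u <- s])%:R * f x) <= b.
Proof.
move=> dhj; elim: r b => [|r IHr] b b0.
  exists m => s E p f /size0nil -> _ _ fV /=; rewrite avgZ.
  apply: (@le_trans _ _ 0); last exact: ltW.
  rewrite mulr_ge0_le0 ?ler0n //.
  have := fV [ffun j => inr j] (fun j => ex_intro _ j (ffunE _ j)).
  rewrite (eq_avg (G := f)) // => x; congr f.
  by apply/ffunP => i; rewrite !ffunE.
have b40 : 0 < b / 4 by lra.
have [K KP] := IHr _ b40.
have [I IP] := insensitive_sum K t0 dhj b40.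
exists I => -[//|t s] E p f [ss] Ei f1 fV.
have half (E' : {ffun I -> option T} -> bool) (p' : seq bool -> bool) : insensitive t E' ->
    avg (fun x => (E' x)%:R * ((p' [seq E u x | u <- s])%:R * f x)) <= b / 2.
  move=> E'i.
  (* By induction the average over each [K]-dimensional subspace is at most [b / 4]; subtracting
     [b / 4] gives the sign condition needed for tiling [E']. *)
  have h : avg (fun x => (E' x)%:R * ((p' [seq E u x | u <- s])%:R * f x - b / 4)) <= b / 4.
    apply: (IP t) => // [x|V Vs].
      case: (p' [seq E u x | u <- s]) => /=.
        by rewrite mul1r; have := f1 x; lra.
      by rewrite mul0r; lra.
    rewrite avgB (avg_cst (X := {ffun K -> option T}) [ffun=> None]) subr_le0.
    apply: (KP s (fun u x => E u (app V x)) p' (fun x => f (app V x))) => // [u|U Us].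
      exact: insensitive_app.
    have := fV _ (app_space_is_space Vs Us).
    by under eq_avg do rewrite -app_app.
  have h2 : avg (fun x => b / 4 * (E' x)%:R) <= b / 4.
    rewrite avgZ ler_piMr //; first lra.
    exact: (dens_le1 None E').
  move: h h2; under eq_avg do rewrite mulrBr [X in _ - X]mulrC.
  by rewrite avgB; lra.
have h1 := half _ (fun l => p (true :: l)) (Ei t).
have h2 := half (fun x => ~~ E t x) (fun l => p (false :: l))
  (fun x y xy => congr1 negb (Ei t x y xy)).
apply: le_trans (_ : b / 2 + b / 2 <= _); last by lra.
apply: le_trans (lerD h1 h2).
rewrite -avgD; apply: ler_avg => x /=.
by case: (E t x); rewrite !(mul1r, mul0r) ?addr0 ?add0r.
Qed.

(** Each deficit [c - F x] is at most the sum of all deficits, which are nonnegative. *)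
Lemma avg_pointwise_ge (X : finType) (F : X -> R) (a c : R) (x : X) :
  (forall y, F y <= c) -> a <= avg F -> c - #|X|%:R * (c - a) <= F x.
Proof.
move=> Fc aF; have X0 := card_inhab x.
have : c - F x <= #|X|%:R * (c - avg F).
  rewrite -{2}(avg_cst x c) -avgB /avg mulrC divfK ?gt_eqF //.
  by rewrite (bigD1 x) //= lerDl sumr_ge0 // => y _; rewrite subr_ge0.
by nra.
Qed.

(** * The density Hales-Jewett theorem *)

Definition somes (T : Type) I (y : {ffun I -> T}) : {ffun I -> option T} :=
  [ffun i => Some (y i)].

(* For uniform [a] this is a random subspace evaluated at [l]: the [None]s of row
   [i] of [a] are the [i]-th wildcard. If [l i = None], row [i] of [spread a l] is
   row [i] of [a], hence uniformly distributed. *)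
Definition spread (T : Type) I J (a : {ffun I * J -> option T}) (l : {ffun I -> option T}) :
  {ffun I * J -> option T} :=
  [ffun p => if a p is Some t then Some t else l p.1].

Definition probe (T : Type) I K J (l : {ffun I -> option T})
    (a : {ffun I * K -> option T}) (z : {ffun J -> option T}) : {ffun I + I * K + J -> option T} :=
  cat_word (cat_word l (spread a l)) z.

(** The words [l] and [somes (inst l u)] are the instances at [None] and [Some u] of one template,
    and [spread] respects this. The copy of [l] in the first block guarantees a wildcard. *)
Lemma probe_line (T : finType) I K J (A : {ffun I + I * K + J -> option T} -> bool) l a z :
  is_line l -> A (probe l a z) -> (forall u : T, A (probe (somes (inst l u)) a z)) ->
  has_line A.
Proof.
move=> [i li] Al Au.
exists (cat_word [ffun k => if cat_word l (spread a l) k is Some t then Some (Some t) else None]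
                 (somes z)).
  by exists (inl (inl i)); rewrite !ffunE li.
case=> [u|]; [have := Au u|have := Al]; congr (is_true (A _));
  apply/ffunP => -[[k|k]|k]; rewrite !ffunE //=.
- by case: (l k).
- by case: (a k) => //=; case: (l k.1).
- by case: (l k).
- by case: (a k) => //=; case: (l k.1).
Qed.

(** As [l i = None], [spread] reproduces row [i] unchanged, so varying that row sweeps out a
    [K]-dimensional subspace. *)
Lemma probe_space (T : finType) I K J (A : {ffun I + I * K + J -> option T} -> bool)
    (l : {ffun I -> option T}) (s : {ffun I * K -> option T}) (z : {ffun J -> option T}) i :
  l i = None ->
  has_line (fun b : {ffun K -> option T} => A (probe l (mix (fun k => (i, k)) s b) z)) ->
  has_line A.
Proof.
move=> li; pose V : {ffun I + I * K + J -> option T + K} :=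
  [ffun q => match q with
   | inl (inl i) => inl (l i)
   | inl (inr p) => if [pick k | (i, k) == p] is Some k then inr k else inl (spread s l p)
   | inr j => inl (z j) end].
have Vs : is_space V.
  move=> k; exists (inl (inr (i, k))); rewrite ffunE; case: pickP => [k' /eqP[->]|/(_ k)] //.
  by rewrite eqxx.
move=> h; apply: (has_line_app Vs); move: h.
congr has_line; apply: funext => b; congr A.
apply/ffunP => -[[k|p]|k]; rewrite !ffunE //=; case: pickP => [k /eqP <-|//] /=.
by rewrite li; case: (b k).
Qed.

(** In row [i], [spread] writes [Some u] wherever [b] has [None], just as if [b] had [Some u]
    there. *)
Lemma probe_insensitive (T : finType) I K J (A : {ffun I + I * K + J -> option T} -> bool)
    (l : {ffun I -> option T}) (s : {ffun I * K -> option T}) (z : {ffun J -> option T}) i u :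
  l i = None ->
  insensitive u (fun b : {ffun K -> option T} =>
    A (probe (somes (inst l u)) (mix (fun k => (i, k)) s b) z)).
Proof.
move=> li b b' bb'; congr A; apply/ffunP => -[[k|p]|k]; rewrite !ffunE //=.
case: pickP => [k /eqP <-|//] /=; rewrite li /=.
have /ffunP/(_ k) := bb'; rewrite !ffunE.
by case: (b k) => [a|]; case: (b' k) => [a'|] //= ->.
Qed.

Lemma DHJ_at_gt1 (T : finType) (t0 : T) (d : R) : 1 < d -> DHJ_at T d.
Proof.
move=> d1; exists unit => A /(lt_le_trans d1).
by rewrite ltNge (dens_le1 t0).
Qed.

Lemma DHJ_at_le (T : finType) (d d' : R) : d <= d' -> DHJ_at T d -> DHJ_at T d'.
Proof. by move=> dd' [I IP]; exists I => A /(le_trans dd') /IP. Qed.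

(* Order of choices: the gap [eta] depends only on [d] and [I0], the block [K] on
   [eta], and only then comes the precision [e] to which fibres are controlled. *)
Lemma DHJ_increment (T : finType) (t0 : T) (d : R) : DHJ T -> 0 < d ->
  (forall g, 0 < g -> DHJ_at (option T) (d + g)) ->
  exists2 e, 0 < e & DHJ_at (option T) (d - e).
Proof.
move=> dhj d0 above.
have [d1|d1] := ltP 1 d.
  exists ((d - 1) / 2); first by lra.
  by apply: (DHJ_at_gt1 None); lra.
have d40 : 0 < d / 2 / 2 by lra.
have d20 : 0 < d / 2 by lra.
have [I0 I0P] := dhj _ d40.
pose C := {ffun I0 -> option T}.
have C1 : 1 <= #|C|%:R :> R by rewrite ler1n; apply/card_gt0P; exists [ffun=> None].
pose th := d / 2 / 2 / #|C|%:R.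
have th0 : 0 < th by rewrite divr_gt0 //; lra.
have th1 : th <= 1 by rewrite ler_pdivrMr ?mul1r; lra.
(* The gain [d * th = 8 * eta] must exceed the losses, which total [3 * eta] in the final
   inequality. *)
pose eta := d * th / 8.
have eta0 : 0 < eta by have := mulr_gt0 d0 th0; rewrite /eta; lra.
have eta1 : eta <= d / 2 by rewrite /eta; nra.
have [m mP] := above _ eta0.
have [K KP] := insensitive_algebra_sum m t0 #|T| dhj eta0.
pose W := {ffun I0 + I0 * K -> option T}.
have W0 : 0 < #|W|%:R :> R by exact: (card_inhab [ffun=> None]).
(* Passing from the average fibre density to each single fibre loses [2 * e] times [#|W|], that is
   [eta]. *)
pose e := eta / (2 * #|W|%:R).
have e0 : 0 < e by apply: divr_gt0 => //; lra.
have [J JP] := above _ e0.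
exists e => //; exists (I0 + I0 * K + J)%type => A dA; apply: contrapT => nA.
have fibre_le u : dens (fun z => A (cat_word u z)) <= d + e.
  rewrite leNgt; apply/negP => /ltW /JP h; apply: nA.
  pose V : {ffun I0 + I0 * K + J -> option T + J} := cat_word (letters J u) [ffun j => inr j].
  have Vs : is_space V by apply: is_space_catr => j; exists j; rewrite ffunE.
  apply: (has_line_app Vs); move: h; congr has_line; apply: funext => z; congr A.
  by rewrite app_cat app_letters; congr cat_word; apply/ffunP => j; rewrite !ffunE.
have fibre_ge u : d - eta <= dens (fun z => A (cat_word u z)).
  move: dA; rewrite {1}/dens avg_cat => /(avg_pointwise_ge u fibre_le).
  apply: le_trans.
  have -> : #|W|%:R * (d + e - (d - e)) = eta.
    by rewrite /e; field; rewrite gt_eqF.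
  by lra.
pose F (q : {ffun I0 * K -> option T} * {ffun J -> option T}) : R :=
  dens (fun y : {ffun I0 -> T} => A (probe (somes y) q.1 q.2)).
pose r (q : {ffun I0 * K -> option T} * {ffun J -> option T}) (l : C) :=
  `[< is_line l /\ forall u, A (probe (somes (inst l u)) q.1 q.2) >].
have [|||l lP] := @avg_pigeonhole _ _ (d / 2) F r d20.
- by move=> q; exact: (dens_le1 t0 _).
- by move=> q /I0P[l ll lA]; exists l; apply/asboolP.
- rewrite /F avg_pair -[leLHS](avg_cst (X := {ffun I0 * K -> option T}) [ffun=> None]).
  apply: ler_avg => a /=; rewrite /dens avg_exchange.
  rewrite -[leLHS](avg_cst (X := {ffun I0 -> T}) [ffun=> t0]).
  by apply: ler_avg => y; apply: le_trans (fibre_ge _); lra.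
have ll : is_line l.
  have [q] := avg_ex (X := ({ffun I0 * K -> option T} * {ffun J -> option T})%type)
    ([ffun=> None], [ffun=> None]) lP.
  by rewrite /r; case: asboolP => [[]//|_]; rewrite -/th /= leNgt th0.
have [i li] := ll.
have hi : injective (fun k : K => (i, k)) by move=> ? ? [].
(* Only row [i] stays random, as the word [b]; the other rows are fixed by [s]. *)
move: lP; rewrite avg_pair (avg_mix None _ hi) => /(avg_ex [ffun=> None])[s].
rewrite avg_exchange.
pose mx (b : {ffun K -> option T}) := mix (fun k => (i, k)) s b.
pose Bz z b := A (probe l (mx b) z).
pose Dz z u b := A (probe (somes (inst l u)) (mx b) z).
move=> sP.
(* On average over [z], [Bz z] has density at least [d - eta] and the intersection of the [Dz z u]
   at least [th]; one weighted sum secures both in a single choice. *)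
have [z zP] : exists z, d - eta + d * th <= dens (Bz z) + d * dens (fun b => [forall u, Dz z u b]).
  apply: (avg_ex (X := {ffun J -> option T}) [ffun=> None]); rewrite avgD avgZ; apply: lerD.
    rewrite /dens avg_exchange -[leLHS](avg_cst (X := {ffun K -> option T}) [ffun=> None]).
    by apply: ler_avg => b; exact: fibre_ge.
  rewrite ler_wpM2l ?(ltW d0) //; apply: le_trans sP _.
  apply: ler_avg => z; apply: ler_avg => b; rewrite ler_nat /r /=.
  case: asboolP => [[_ h]|//]; suff -> : [forall u, Dz z u b] by [].
  by apply/forallP.
have BD b : Bz z b && [forall u, Dz z u b] = false.
  apply/negbTE/negP => /andP[Bb /forallP Db]; apply: nA.
  exact: probe_line ll Bb Db.
have sT : size (enum T) = #|T| by rewrite -cardE.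
have Di u : insensitive u (Dz z u) by exact: probe_insensitive.
have f1 b : (Bz z b)%:R - (d + eta) <= 1.
  by have : (Bz z b)%:R <= 1 :> R; [rewrite lern1 leq_b1|lra].
have fV (V : {ffun K -> option T + m}) : is_space V ->
    avg (fun x => (Bz z (app V x))%:R - (d + eta)) <= 0.
  move=> Vs; rewrite avgB (avg_cst (X := {ffun m -> option T}) [ffun=> None]) subr_le0 leNgt.
  apply/negP => /ltW /mP h; apply: nA; apply: (probe_space li (s := s) (z := z)).
  exact: has_line_app Vs h.
have := KP _ _ (fun bs => ~~ all id bs) _ sT Di f1 fV.
(* Restricting to the complement of the intersection loses nothing of [Bz z]; only the constant
   [d + eta] needs correcting. *)
have -> : avg (fun b => (~~ all id [seq Dz z u b | u <- enum T])%:R * ((Bz z b)%:R - (d + eta)))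
   = avg (fun b => (Bz z b)%:R - (d + eta) + (d + eta) * [forall u, Dz z u b]%:R).
  apply: eq_avg => b.
  have -> : all id [seq Dz z u b | u <- enum T] = [forall u, Dz z u b].
    rewrite all_map; apply/allP/forallP => [h u|h u _]; last exact: h.
    by apply: h; rewrite mem_enum.
  have := BD b; case: (Bz z b) => /= [->|_];
  by case: [forall u, Dz z u b] => /=; rewrite ?mulr1; ring.
rewrite avgD avgB avgZ (avg_cst (X := {ffun K -> option T}) [ffun=> None]).
rewrite -!/(dens _).
have : 0 <= dens (fun b => [forall u, Dz z u b]) by apply: avg_ge0 => x; rewrite ler0n.
have : d * th = 8 * eta by rewrite /eta; field.
by nra.
Qed.

Lemma DHJ_option (T : finType) (t0 : T) : DHJ T -> DHJ (option T).
Proof.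
move=> dhj.
pose S := [set d : R | 0 < d /\ DHJ_at (option T) d].
have S2 : S 2 by split=> //; apply: (DHJ_at_gt1 None); lra.
have Slb : has_inf S by split; [exists 2|exists 0 => d [/ltW]].
have near_inf g : 0 < g -> exists2 d, S d & d < inf S + g.
  by move=> g0; have [d Sd dg] := inf_adherent g0 Slb; exists d.
have [i0|i0] := ltP 0 (inf S); last first.
  move=> d /near_inf[d' [_ d'P] d'd]; apply: DHJ_at_le d'P.
  by lra.
have [|e e0 eP] := DHJ_increment t0 dhj i0.
  by move=> g /near_inf[d [_ dP] dg]; apply: DHJ_at_le dP; exact: ltW.
(* The maximum keeps the density positive even if [inf S - e] is not. *)
have : S (Num.max (inf S - e) (inf S / 2)).
  by split; [rewrite lt_max; apply/orP; right; lra|apply: DHJ_at_le eP; rewrite le_max lexx].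
move=> /(inf_lbound Slb.2); rewrite le_max => /orP[|] h; exfalso; lra.
Qed.

Lemma DHJ_unit : DHJ unit.
Proof.
move=> d d0; exists unit => A /(lt_le_trans d0) /(dens_ex tt)[x Ax].
exists [ffun=> None]; first by exists tt; rewrite ffunE.
by move=> t; rewrite (_ : inst _ t = x) //; apply/ffunP => i; case: (x i) => //; case: (inst _ _ _).
Qed.

Lemma DHJ_large (n : nat) : exists2 T : finType, (n < #|T|)%N & DHJ T.
Proof.
elim: n => [|n [T nT dhj]]; first by exists unit; [rewrite card_unit|exact: DHJ_unit].
have [t0 _] : exists t : T, t \in T by apply/card_gt0P; exact: leq_ltn_trans nT.
by exists (option T); [rewrite card_option|exact: DHJ_option t0 dhj].
Qed.

End DensityHalesJewett.

(** * Return sets *)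

Section Return.
Variables (R : realType) (D : nat).
Implicit Types (x y c e : R).

Let q : R := Num.sqrt D%:R.

(* [x] is m + n sqrt D with conjugate at most [c] in absolute value, for some
   representation: if D is a square there are several. *)
Definition conj_le (c x : R) : Prop :=
  exists m n : int, x = m%:~R + n%:~R * q /\ `|m%:~R - n%:~R * q| <= c.

Lemma sqrtD_ge1 : (0 < D)%N -> 1 <= q.
Proof. by move=> D0; rewrite -[1]sqrtr1 ler_wsqrtr // ler1n. Qed.

Lemma sqrtD_sqr : q * q = D%:R.
Proof. by rewrite -expr2 sqr_sqrtr ?ler0n. Qed.

Lemma conj_le_ge0 c x : conj_le c x -> 0 <= c.
Proof. by move=> [m [n [_]]]; exact: le_trans. Qed.

Lemma conj_leW c d x : c <= d -> conj_le c x -> conj_le d x.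
Proof. by move=> cd [m [n [xE h]]]; exists m, n; split=> //; exact: le_trans cd. Qed.

Lemma conj_le0 : conj_le 0 0.
Proof. by exists 0, 0; rewrite mul0r addr0 subr0 normr0. Qed.

Lemma conj_leD c d x y : conj_le c x -> conj_le d y -> conj_le (c + d) (x + y).
Proof.
move=> [m [n [-> h]]] [m' [n' [-> h']]]; exists (m + m'), (n + n').
rewrite !intrD; split; first by ring.
rewrite (_ : _ - _ = (m%:~R - n%:~R * q) + (m'%:~R - n'%:~R * q)); last by ring.
by apply: le_trans (ler_normD _ _) _; exact: lerD.
Qed.

Lemma conj_leN c x : conj_le c x -> conj_le c (- x).
Proof.
move=> [m [n [-> h]]]; exists (- m), (- n); rewrite !intrN; split; first by ring.
by rewrite (_ : _ - _ = - (m%:~R - n%:~R * q)) ?normrN //; ring.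
Qed.

Lemma conj_leB c d x y : conj_le c x -> conj_le d y -> conj_le (c + d) (x - y).
Proof. by move=> hx /conj_leN; exact: conj_leD. Qed.

Lemma conj_leM c d x y : conj_le c x -> conj_le d y -> conj_le (c * d) (x * y).
Proof.
move=> [m [n [-> h]]] [m' [n' [-> h']]].
exists (m * m' + n * n' * D%:Z), (m * n' + n * m').
have qq := sqrtD_sqr; rewrite !intrD !intrM -[D%:Z%:~R]/(D%:R) -qq; split; first by ring.
rewrite (_ : _ - _ = (m%:~R - n%:~R * q) * (m'%:~R - n'%:~R * q)); last by ring.
by rewrite normrM ler_pM.
Qed.

Lemma conj_le_sum (I : finType) (P : pred I) c (f : I -> R) : 0 <= c ->
  (forall i, conj_le c (f i)) -> conj_le (#|I|%:R * c) (\sum_(i | P i) f i).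
Proof.
move=> c0 hf; rewrite big_mkcond mulr_natl -sumr_const.
apply: (big_rec2 (fun a b => conj_le b a)) => [|i b a _ h]; first exact: conj_le0.
apply: conj_leD => //; case: ifP => // _.
exact: conj_leW c0 conj_le0.
Qed.

(* One representative for each cell of length [e] met by the conjugates; no
   density of the conjugates is needed. *)
Lemma conj_cover e : 0 < e ->
  exists2 K : set R, finite_set K &
    forall x, conj_le 1 x -> exists2 k, K k & conj_le e (x - k).
Proof.
move=> e0; pose B := Num.bound e^-1.
have Bge : e^-1 < B%:R by apply: archi_boundP; rewrite invr_ge0 ltW.
pose cell (j : nat) (x : R) := exists m n : int,
  [/\ x = m%:~R + n%:~R * q, `|m%:~R - n%:~R * q| <= 1 &
     Num.truncn ((m%:~R - n%:~R * q) / e + B%:R) = j].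
have /choice[k kP] : forall j, exists k, forall x, cell j x -> cell j k.
  move=> j; have [[k jk]|nk] := pselect (exists k, cell j k); first by exists k.
  by exists 0 => x jx; case: nk; exists x.
have e10 : 0 <= e^-1 by rewrite invr_ge0 ltW.
(* Adding [B] makes the scaled conjugates nonnegative, where [truncn] is a true floor. *)
have big y : `|y| <= 1 -> 0 <= y / e + B%:R < (2 * B)%:R.
  move=> y1; have : `|y / e| <= e^-1.
    by rewrite normrM (ger0_norm e10) ler_piMl.
  by rewrite ler_norml natrM => /andP[]; lra.
exists [set k j | j in `I_(2 * B)]; first exact/finite_image/finite_II.
move=> x [m [n [xE h]]].
pose j := Num.truncn ((m%:~R - n%:~R * q) / e + B%:R).
have xj : cell j x by exists m, n.
have [m' [n' [kE h' jE]]] := kP j x xj.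
have /andP[p1 p2] := big _ h; have /andP[p1' _] := big _ h'.
exists (k j).
  exists j => //=; rewrite -(ltr_nat R); apply: le_lt_trans p2.
  by have /andP[] := truncn_itv p1.
exists (m - m'), (n - n'); rewrite xE kE !intrB; split; first by ring.
have := truncn_itv p1; have := truncn_itv p1'; rewrite jE -/j -natr1.
set u := _ - _ * q; set v := _ - _ * q => /andP[a1 a2] /andP[b1 b2].
rewrite (_ : _ - _ = (v / e + B%:R - (u / e + B%:R)) * e); last first.
  by rewrite /u /v; field; rewrite gt_eqF.
rewrite normrM (gtr0_norm e0); apply: ler_piMl; first exact: ltW.
by rewrite ler_norml; lra.
Qed.

(** Since [2 * n * q] is [x] minus its conjugate, [n] takes linearly many values; then [m] is within
    2 of [n * q]. *)
Lemma conj_window : (0 < D)%N -> exists C : nat, forall M : nat, exists X : seq R,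
  (size X <= C * M.+1)%N /\ forall x, conj_le 2 x -> `|x| <= M%:R -> x \in X.
Proof.
move=> D0; exists 30%N => M.
(* Here [i] encodes [n + M + 2], and [j] encodes [m + 2] minus the floor of [n * q]. *)
pose g (i j : nat) : R :=
  (Num.floor ((i%:Z - (M + 2)%N%:Z)%:~R * q) + j%:Z - 2)%:~R + (i%:Z - (M + 2)%N%:Z)%:~R * q.
exists [seq g i j | i <- iota 0 (2 * M + 5), j <- iota 0 5].
split; first by rewrite size_allpairs !size_iota; lia.
move=> x [m [n [xE h]]] xM; have q1 := sqrtD_ge1 D0.
have nq : `|n%:~R * q| <= M%:R + 2.
  move: h xM; rewrite xE !ler_norml => /andP[h1 h2] /andP[h3 h4].
  by have M0 : 0 <= M%:R :> R := ler0n _ M; lra.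
have nM : `|n| <= (M + 2)%N%:Z.
  rewrite -(ler_int R) intr_norm (le_trans _ (_ : M%:R + 2 <= _)) //; last first.
    by rewrite -[X in _ <= X]/((M + 2)%N%:R) natrD.
  by apply: le_trans nq; rewrite normrM ler_peMr // ger0_norm //; lra.
pose i := absz (n + (M + 2)%N%:Z).
have iE : i%:Z - (M + 2)%N%:Z = n by rewrite /i; lia.
pose fl := Num.floor (n%:~R * q).
have [fl1 fl2] : fl%:~R <= n%:~R * q /\ n%:~R * q < (fl + 1)%:~R.
  by apply/andP; exact: floor_itv.
have [l1 l2] : -2 <= m - fl /\ m - fl < 3.
  move: h; rewrite ler_norml intrD in fl2 * => /andP[h1 h2].
  split; [rewrite -(ler_int R)|rewrite -(ltr_int R)]; rewrite intrB /=.
    by rewrite intrN; lra.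
  by lra.
pose j := absz (m - fl + 2).
have jE : j%:Z = m - fl + 2 by rewrite /j; lia.
apply/allpairsP; exists (i, j); split; rewrite ?mem_iota /=.
- by rewrite /i; lia.
- by lia.
- by rewrite /g iE -/fl jE xE; congr (_%:~R + _); lia.
Qed.

(** * Upper density and translates *)

Lemma limn_esup_frequently (u : nat -> \bar R) : (0 < limn_esup u)%E ->
  exists2 d : R, 0 < d & forall N, exists2 n, (N <= n)%N & (d%:E < u n)%E.
Proof.
move=> u0; have [d d0 du] : exists2 d : R, 0 < d & (d%:E < limn_esup u)%E.
  case: (limn_esup u) u0 => [r| |//] r0.
    by exists (r / 2); move: r0; rewrite ?lte_fin => r0; lra.
  by exists 1; rewrite ?ltry.
exists d => // N.
have : (d%:E < ereal_sup [set u n | n in [set n | (N <= n)%N]])%E.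
  apply: lt_le_trans du _; apply: ereal_inf_lbound.
  by exists [set n | (N <= n)%N] => //; exists N.
by move=> /ereal_sup_gt[_ [n Nn <-]]; exists n.
Qed.

(** Double counting of the pairs [(a, w)]: for each [w], the points [x] of [P] in a window give as
    many values [a = x - v w], all in a list of size linear in the window. *)
Lemma dense_translate (P : set R) : (0 < D)%N -> P `<=` Lambda R D -> (0 < upper_density P)%E ->
  exists2 d : R, 0 < d & forall (W : finType) (w0 : W) (v : W -> R),
    (forall w, conj_le 1 (v w)) -> exists a, d <= avg (fun w => `[< P (a + v w) >]%:R).
Proof.
move=> D0 PL /limn_esup_frequently[d d0 dP].
have [C CP] := conj_window D0.
exists (d / 2 / C.+1%:R); first by rewrite !divr_gt0.
move=> W w0 v v1; pose B := Num.bound (\sum_w `|v w|).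
have vB w : `|v w| <= B%:R.
  apply: le_trans (ltW (archi_boundP _)); last exact: sumr_ge0.
  by rewrite (bigD1 w) //= lerDl sumr_ge0.
(* As [n] exceeds the bound [B] on the shifts, enlarging the radius by [B] at most doubles it. *)
have [n Bn] := dP B.+1; set Pn := P `&` _ => un.
have n0 : 0 < n%:R :> R by rewrite ltr0n; exact: leq_trans Bn.
have [X [sX XP]] := CP (n + B)%N.
have Pnwin x w : Pn x -> x - v w \in X.
  move=> [Px /=]; rewrite in_itv /= -ler_norml => xn; apply: XP.
    by rewrite (_ : 2 = 1 + 1) //; apply: conj_leB => //; exact: PL.
  by rewrite natrD; apply: le_trans (ler_normB _ _) _; exact: lerD.
have finPn : finite_set Pn.
  apply: (@sub_finite_set _ _ [set y + v w0 | y in [set` X]]); last exact/finite_image/finite_seq.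
  by move=> x /(Pnwin _ w0) xX; exists (x - v w0); rewrite // subrK.
pose s : seq R := finmap.enum_fset (fset_set Pn).
have sP x : (x \in s) = (x \in Pn) by rewrite -(in_fset_set finPn).
have ss : d * (2 * n%:R) <= (size s)%:R.
  move: un; rewrite /counting; case: asboolP => // _.
  have n20 : 0 < 2 * n%:R :> R by rewrite mulr_gt0.
  by rewrite -EFinM lte_fin ltr_pdivlMr // => /ltW.
have : (size s)%:R <= avg (fun w => \sum_(a <- X) `[< P (a + v w) >]%:R) :> R.
  rewrite -[leLHS](avg_cst w0); apply: ler_avg => w.
  rewrite -natr_sum ler_nat -big_mkcond sum1_count -size_filter.
  rewrite -(size_map (fun x => x - v w)); apply: uniq_leq_size.
    by rewrite map_inj_uniq ?finmap.fset_uniq // => x y /addIr.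
  move=> _ /mapP[x + ->]; rewrite sP => /set_mem xP.
  by rewrite mem_filter Pnwin // andbT subrK; apply/asboolP; case: xP.
rewrite avg_sum => h; apply: contrapT => /forallNP none.
have sX2 : (size X)%:R <= C.+1%:R * (2 * n%:R) :> R.
  by rewrite -!natrM ler_nat; nia.
have : \sum_(a <- X) avg (fun w => `[< P (a + v w) >]%:R) <= d / 2 / C.+1%:R * (size X)%:R.
  rewrite -sum1_size natr_sum mulr_sumr; apply: ler_sum => a _.
  by rewrite mulr1 ltW // ltNge; exact/negP/none.
have dC : 0 < d / 2 / C.+1%:R by rewrite !divr_gt0.
move: sX2; rewrite -(ler_pM2l dC) => sX2 h2.
have := le_trans (le_trans ss h) (le_trans h2 sX2).
by rewrite [leRHS]mulrA divfK ?pnatr_eq0 //; nra.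
Qed.

(** Greedy choice: if every [x] of small conjugate had [x + y] in [S] for some earlier subset sum
    [y], then finitely many shifts [k - y] of [S] would cover [Lambda R D]. *)
Lemma thick_sums (S : set R) e : 0 < e ->
  (forall K : set R, finite_set K -> ~ Lambda R D `<=` [set s + k | s in S & k in K]) ->
  forall n : nat, exists2 l : nat -> R, (forall i, conj_le e (l i)) &
    forall Q : pred nat, (exists2 i, (i < n)%N & Q i) -> ~ S (\sum_(i < n | Q i) l i).
Proof.
move=> e0 thick; elim=> [|n [l le lS]].
  exists (fun _ => 0); last by move=> Q [].
  by move=> _; apply: conj_leW (ltW e0) conj_le0.
have [K finK KP] := conj_cover e0.
(* The empty subset contributes 0, so [x] itself avoids [S] too. *)
pose N := range (fun B : {set 'I_n} => \sum_(i in B) l i).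
have finN : finite_set N by apply: finite_image; exact: finite_finset.
have NP (Q : pred nat) : N (\sum_(i < n | Q i) l i).
  by exists [set i : 'I_n | Q i]%SET => //; apply: eq_bigl => i; rewrite inE.
have [x xe xS] : exists2 x, conj_le e x & forall y, N y -> ~ S (x + y).
  apply: contrapT => none.
  apply: (thick [set k - y | k in K & y in N]); first exact: finite_image2.
  move=> x /KP[k Kk xk].
  have [y Ny Sy] : exists2 y, N y & S (x - k + y).
    apply: contrapT => nN; apply: none; exists (x - k) => // y Ny Sy.
    by apply: nN; exists y.
  exists (x - k + y) => //; exists (k - y); first by exists k => //; exists y.
  by ring.
exists (fun i => if (i < n)%N then l i else x) => [i|Q [i ilt Qi]].
  by case: ifP.
rewrite big_mkcond big_ord_recr -big_mkcond /= ltnn.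
rewrite (eq_bigr (fun i : 'I_n => l i)); last by move=> j _; rewrite ltn_ord.
case: ifP => Qn; first by rewrite addrC; exact: xS.
rewrite addr0; apply: lS; exists i => //.
by move: ilt; rewrite ltnS leq_eqVlt => /predU1P[ni|//]; rewrite -ni Qi in Qn.
Qed.

Lemma return_syndetic (P F : set R) : (0 < D)%N ->
  P `<=` Lambda R D -> (0 < upper_density P)%E -> finite_set F -> F `<=` Zsqrt R D ->
  syndetic_in (Lambda R D) (return_set (Lambda R D) P F).
Proof.
move=> D0 PL Pd /finite_seqP[s Fs] FZ; split; first by move=> l [].
set S := return_set _ _ _; apply: contrapT => nS.
have {}nS K : finite_set K -> ~ Lambda R D `<=` [set s + k | s in S & k in K].
  by move=> finK LK; apply: nS; exists K.
(* The added 0 makes [base] itself a point of the line, hence of [P]. *)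
pose s0 := 0 :: s.
have [T sT dhj] := DHJ_large R (size s0).
have [d d0 dP] := dense_translate D0 PL Pd.
(* Surplus letters receive the default 0, already an element of [s0]. *)
pose g (t : T) : R := nth 0 s0 (enum_rank t).
have gP f : f \in s0 -> exists t, g t = f.
  move=> fs; have it : (index f s0 < #|T|)%N.
    by apply: leq_ltn_trans sT; exact: index_size.
  by exists (enum_val (Ordinal it)); rewrite /g enum_valK nth_index.
have [t0 gt0] := gP 0 (mem_head _ _).
have /choice[c cP] : forall t, exists c, conj_le c (g t).
  move=> t; have [sr|] := boolP (g t \in s0); last first.
    move=> gs; exists 0; suff -> : g t = 0 by exact: conj_le0.
    by apply: nth_default; rewrite leqNgt; apply: contra gs => ?; exact: mem_nth.
  move: sr; rewrite inE => /predU1P[->|gs]; first by exists 0; exact: conj_le0.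
  have [|m [k xE]] := FZ (g t); first by rewrite Fs.
  by exists `|m%:~R - k%:~R * Num.sqrt D%:R|; exists m, k.
pose B := 1 + \sum_t c t.
have c0 t : 0 <= c t by exact: conj_le_ge0 (cP t).
have cB t : conj_le B (g t).
  apply: conj_leW (cP t); rewrite /B (bigD1 t) //= addrCA lerDl addr_ge0 //.
  exact: sumr_ge0.
have B1 : 1 <= B by rewrite lerDl sumr_ge0.
have [I IP] := dhj _ d0.
(* Then a sum of [#|I|] products of some [l i] with a letter has conjugate at most 1. *)
pose e := (B * #|I|.+1%:R)^-1.
have e0 : 0 < e by rewrite invr_gt0 mulr_gt0 //; lra.
have eB : #|I|%:R * (e * B) <= 1.
  rewrite /e invfM mulrAC mulVf ?mul1r; last by rewrite gt_eqF //; lra.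
  by rewrite ler_pdivrMr // mul1r ler_nat.
have [l le lS] := thick_sums e0 nS #|I|.
pose L (i : I) := l (enum_rank i).
have w0 : {ffun I -> T} := [ffun=> t0].
have [|a aP] := dP _ w0 (fun w : {ffun I -> T} => \sum_i L i * g (w i)).
  move=> w; apply: conj_leW eB _; apply: conj_le_sum => [|i]; first by rewrite mulr_ge0 //; lra.
  by apply: conj_leM; [exact: le|exact: cB].
have [w [i0 wi0] wP] := IP _ aP.
(* The wildcards of the line go into [lam], its fixed letters into [base]. *)
pose lam := \sum_(i | w i == None) L i.
pose base := a + \sum_i (if w i is Some t then L i * g t else 0).
have baseP t : P (base + lam * g t).
  have /asboolP := wP t; congr P; rewrite /base -addrA; congr (_ + _).
  rewrite /lam mulr_suml [X in _ = _ + X]big_mkcond -big_split; apply: eq_bigr => i _ /=.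
  by rewrite ffunE; case: (w i) => [u|] /=; rewrite ?addr0 ?add0r.
have Slam : S lam.
  split.
    apply: (@conj_leW (#|I|%:R * e)); last first.
      by apply: conj_le_sum => [|i]; [exact: ltW|exact: le].
    by apply: le_trans eB; rewrite ler_wpM2l // ler_peMr // ltW.
  exists base; first by have := baseP t0; rewrite gt0 mulr0 addr0.
  move=> _ [_ [f Ff <-] <-].
  have [|t <-] := gP f; last exact: baseP.
  by move: Ff; rewrite Fs /= inE => ->; rewrite orbT.
pose Q k := [exists i : I, (enum_rank i == k :> nat) && (w i == None)].
have QE i : Q (enum_rank i) = (w i == None).
  apply/existsP/idP => [[j /andP[/eqP/val_inj/enum_rank_inj ->]]//|wi].
  by exists i; rewrite eqxx.
apply: (lS Q); first by exists (enum_rank i0); [exact: ltn_ord|rewrite QE wi0].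
rewrite (reindex enum_rank) /=; last exact/onW_bij/enum_rank_bij.
by rewrite (eq_bigl _ _ QE).
Qed.

End Return.

Theorem theorem1p2 (R : realType) (D : nat) (P0 : set R) :
  (0 < D)%N -> square_free D ->
  P0 `<=` Lambda R D ->
  (0 < upper_density P0)%E ->
  forall F : set R, finite_set F -> F `<=` Zsqrt R D ->
    syndetic_in (Lambda R D) (return_set (Lambda R D) P0 F).
Proof. by move=> D0 _ PL Pd F finF FZ; exact: return_syndetic. Qed.
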